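(* Let $A\in\mathbb{R}^{n\times m}$ be the incidence matrix of a connected directed graph (without self-loops) with $n$ nodes and $m$ edges. Let $f:\mathbb{R}^m\to\mathbb{R}^m$ be a differentiable (possibly nonlinear) map with diagonal structure $f=f_1\times\dots\times f_m$, that is, $f(u)=(f_1(u_1),\dots,f_m(u_m))$ with $f_j:\mathbb{R}\to\mathbb{R}$. Consider the dynamical system $$x'=F(x),\qquad F(x)=-Af(A^{\mathsf T}x),\qquad x\in\mathbb{R}^n,$$ and let $x^*$ be an equilibrium point of it. Assign to each edge $j$ the weight $W_j=f_j'\big((A^{\mathsf T})_jx^*\big)$, where $(A^{\mathsf T})_j$ is the $j$-th row of $A^{\mathsf T}$, and let $W=\mathrm{diag}(W_1,\dots,W_m)$. Then the Jacobian matrix $F'(x^* )=-AWA^{\mathsf T}$ has corank one if and only if the sum of the weights of all spanning trees of the digraph does not vanish. Moreover, if this sum is not null, then the set of equilibria of the system is a curve locally around $x^*$.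
   Context: The incidence matrix $A=(a_{ij})$ of a digraph has $a_{ij}=1$ if edge $j$ leaves node $i$, $a_{ij}=-1$ if edge $j$ enters node $i$, and $a_{ij}=0$ if edge $j$ is not incident with node $i$. Connectedness and spanning trees refer to the underlying undirected graph. The weight of a spanning tree is the product of the weights of its edges. The corank of an $n\times n$ matrix is $n$ minus its rank. Weights may be positive, negative or zero. ''A curve locally around $x^*$'' means that, in some neighborhood of $x^*$, the set of equilibria is a one-dimensional submanifold of $\mathbb{R}^n$. *)

(* Defs.v *)
From HB Require Import structures.
From mathcomp Require Import all_boot all_order all_algebra.
From mathcomp Require Import all_classical all_reals all_analysis.

Set Implicit Arguments.
Unset Strict Implicit.
Unset Printing Implicit Defensive.

Import Order.TTheory GRing.Theory Num.Theory.
Import numFieldNormedType.Exports.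

Local Open Scope classical_set_scope.
Local Open Scope ring_scope.

(* Edges are labelled, so parallel and antiparallel edges are allowed. *)
Record digraph (n m : nat) := Digraph {
  tail : 'I_m -> 'I_n;
  head : 'I_m -> 'I_n;
  loopless : forall j, tail j != head j }.

Section Graphs.
Variables (n m : nat) (G : digraph n m).

(* The sign convention: edge j leaves [tail G j] and enters [head G j]. *)
Definition incidence_mx (R : pzRingType) : 'M[R]_(n, m) :=
  \matrix_(i, j) (if i == tail G j then 1 else if i == head G j then -1 else 0).

Definition adjacent_by (T : {set 'I_m}) : rel 'I_n := fun u v =>
  [exists j in T, ((tail G j == u) && (head G j == v))
               || ((head G j == u) && (tail G j == v))].

(* The graph with all the nodes and the edge set T; the node set of a connected
   graph is nonempty. *)
Definition connected_by (T : {set 'I_m}) : bool :=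
  (0 < n)%N && [forall u, forall v, connect (adjacent_by T) u v].

Definition digraph_connected : bool := connected_by [set: 'I_m].

(* A step (j, b) traverses the edge j from tail to head if b = true, and from
   head to tail if b = false. *)
Definition step_src (s : 'I_m * bool) := if s.2 then tail G s.1 else head G s.1.
Definition step_dst (s : 'I_m * bool) := if s.2 then head G s.1 else tail G s.1.

(* Distinctness of the edges rules out going back and forth along one edge;
   two parallel edges do form a cycle. *)
Definition graph_cycle (T : {set 'I_m}) (c : seq ('I_m * bool)) : bool :=
  [&& c != [::], all (fun s => s.1 \in T) c,
      cycle (fun s t => step_dst s == step_src t) c,
      uniq (map fst c) & uniq (map step_src c)].

Definition acyclic (T : {set 'I_m}) : Prop := forall c, ~~ graph_cycle T c.

Definition spanning_tree (T : {set 'I_m}) : bool :=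
  connected_by T && `[< acyclic T >].

Definition tree_weight_sum (R : comPzRingType) (w : 'I_m -> R) : R :=
  \sum_(T : {set 'I_m} | spanning_tree T) \prod_(j in T) w j.

End Graphs.

Definition corank (F : fieldType) (n : nat) (M : 'M[F]_n) : nat := (n - \rank M)%N.

Section Calculus.
Variable R : realType.

Definition diag_map (m : nat) (f : 'I_m -> R -> R) (u : 'cV[R]_m) : 'cV[R]_m :=
  \col_j f j (u j 0).

(* Acts on column vectors; the library's [jacobian] acts on row vectors and is
   the transpose of this one. *)
Definition jacobian_mx (n p : nat) (F : 'cV[R]_n -> 'cV[R]_p) (x : 'cV[R]_n) :
    'M[R]_(p, n) :=
  \matrix_(i, j) 'D_(delta_mx j 0) (fun y => F y i 0) x.

(* The equilibria of x' = F(x). *)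
Definition equilibria (n : nat) (F : 'cV[R]_n -> 'cV[R]_n) : set 'cV[R]_n :=
  [set x | F x = 0].

(* For U open this is being of class C^k on U: g is of class C^(k+1) iff it is
   differentiable and each of its directional derivatives is of class C^k. *)
Fixpoint class_C (k : nat) (n p : nat) (U : set 'cV[R]_n)
    (g : 'cV[R]_n -> 'cV[R]_p) : Prop :=
  if k is k'.+1 then
    (forall x, U x -> differentiable g x) /\
    (forall v : 'cV[R]_n, class_C k' U (fun x => 'D_v g x))
  else forall x, U x -> {for x, continuous g}.

Definition smooth_on (n p : nat) (U : set 'cV[R]_n) (g : 'cV[R]_n -> 'cV[R]_p) :=
  forall k, class_C k U g.

Definition diffeomorphism (n : nat) (U V : set 'cV[R]_n)
    (phi psi : 'cV[R]_n -> 'cV[R]_n) : Prop :=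
  [/\ smooth_on U phi, smooth_on V psi,
      forall x, U x -> V (phi x) /\ psi (phi x) = x
    & forall y, V y -> U (psi y) /\ phi (psi y) = y].

(* Embedded smooth submanifold of R^n of dimension d, by local charts of R^n
   that flatten S to R^d x {0}. *)
Definition submanifold (d n : nat) (S : set 'cV[R]_n) : Prop :=
  (d <= n)%N /\
  forall p, S p -> exists (U V : set 'cV[R]_n) (phi psi : 'cV[R]_n -> 'cV[R]_n),
    [/\ open U, open V, U p, diffeomorphism U V phi psi
      & forall x, U x ->
          (S x <-> forall i : 'I_n, (d <= i)%N -> phi x i 0 = 0)].

Definition locally_curve (n : nat) (S : set 'cV[R]_n) (x : 'cV[R]_n) : Prop :=
  S x /\ exists N : set 'cV[R]_n, [/\ open N, N x & submanifold 1 (S `&` N)].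

End Calculus.

(* Main.v *)
Require Import Defs.
From mathcomp Require Import all_boot all_order all_algebra.
From mathcomp Require Import all_classical all_reals all_analysis.
From mathcomp Require Import perm zify lra.
Import Order.TTheory GRing.Theory Num.Theory.
Import numFieldNormedType.Exports.
Local Open Scope classical_set_scope.
Local Open Scope ring_scope.

(** Let L = A W A^T be the weighted Laplacian of the graph, and let 1 be the
    constant vector.  Since L 1 = 0 and 1^T L = 0, the corank of L is one if
    and only if L plus a unit entry at the place (0, 0) is invertible
    ([corank1_unitmx]), and the determinant of that matrix is the minor of L
    obtained by dropping the row and the column 0 ([det_add_delta00]).

    This minor is the sum of the weights of the spanning trees, whatever the
    signs of the weights ([matrix_tree]): the Cauchy-Binet formula
    ([det_mul_diag_mx]) expands it over the sets T of n - 1 edges, n being the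
    number of nodes, and the coefficient of such a set is the squared
    determinant of the incidence matrix of T without its row 0.  Connectedness
    of T amounts to the independence of the rows of this matrix
    ([connected_grounded_right_inverse], [disconnected_grounded_cokernel]) and
    acyclicity to the independence of its columns ([acyclic_independent],
    [graph_cycle_dependency]).  For a tree, the inverse has integer entries,
    so that the determinant is 1 or -1 ([det_grounded_edges]).

    The chain rule gives -L as the Jacobian matrix ([diff_flow]).  As the
    derivatives of the f j need not be continuous, the implicit function
    theorem does not apply to the set of equilibria; but F is invariant under
    the translations along 1, so that a whole line of equilibria goes through
    xstar.  If the sum over the trees is not zero, then the differential of F
    at xstar is injective on the hyperplane h_0 = 0, a complement of that
    line, and mere differentiability at xstar shows that xstar is an isolated
    zero of F on xstar plus this hyperplane ([isolated_level]).  Near xstar,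
    the equilibria are thus exactly the points of the line
    ([translation_invariant_curve]). *)

Set Implicit Arguments.
Unset Strict Implicit.
Unset Printing Implicit Defensive.

(** * Determinants *)

Section CauchyBinet.
Variables (R : comPzRingType) (n m : nat).

(** Multilinearity of the determinant in the rows of B *m C, each of which is
    a combination of the rows of C. *)
Lemma det_mulmx_ffun (B : 'M[R]_(n, m)) (C : 'M[R]_(m, n)) :
  \det (B *m C) =
    \sum_(phi : {ffun 'I_n -> 'I_m})
      (\prod_i B i (phi i)) * \det (rowsub phi C).
Proof.
pose BC (s : 'S_n) i j := B i j * C j (s i).
transitivity (\sum_(phi : {ffun 'I_n -> 'I_m}) \sum_(s : 'S_n)
                (-1) ^+ s * \prod_i BC s i (phi i)).
  rewrite exchange_big; apply: eq_bigr => /= s _; rewrite -big_distrr /=.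
  congr (_ * _); rewrite -(bigA_distr_bigA (BC s)) /=.
  by apply: eq_bigr => i _; rewrite mxE.
apply: eq_bigr => phi _; rewrite big_distrr /=; apply: eq_bigr => s _.
rewrite big_split /= mulrCA; congr (_ * (_ * _)).
by apply: eq_bigr => i _; rewrite !mxE.
Qed.

Definition set_diag (S : {set 'I_m}) : 'M[R]_m :=
  diag_mx (\row_j (j \in S)%:R).

(** The Cauchy-Binet formula, with the m weights kept apart.  The maps phi that
    survive in the expansion [det_mulmx_ffun] are the injective ones, and they
    are sorted here by their image S.  The product of the two maximal minors
    attached to S is written as one determinant, with the weights put to 1
    in S and to 0 elsewhere, so that no enumeration of S is involved. *)
Lemma det_mul_diag_mx (B : 'M[R]_(n, m)) (C : 'M[R]_(m, n)) (w : 'I_m -> R) :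
  \det (B *m diag_mx (\row_j w j) *m C) =
    \sum_(S : {set 'I_m} | #|S| == n)
      (\prod_(j in S) w j) * \det (B *m set_diag S *m C).
Proof.
pose K (phi : {ffun 'I_n -> 'I_m}) :=
  (\prod_i B i (phi i)) * \det (rowsub phi C).
have expand v : \det (B *m diag_mx (\row_j v j) *m C) =
    \sum_(phi : {ffun 'I_n -> 'I_m} | injectiveb phi)
      (\prod_i v (phi i)) * K phi.
  rewrite det_mulmx_ffun [RHS]big_mkcond; apply: eq_bigr => phi _ /=.
  have -> : \prod_i (B *m diag_mx (\row_j v j)) i (phi i)
            = (\prod_i v (phi i)) * \prod_i B i (phi i).
    rewrite -big_split; apply: eq_bigr => i _ /=.
    rewrite mul_mx_diag !mxE mulrC //.
  rewrite -mulrA; case: injectiveP => // /injectiveP/injectivePn [i [k ik e]].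
  rewrite (determinant_alternate ik) ?mulr0 // => j.
  by rewrite !mxE e.
rewrite expand.
rewrite (partition_big (fun phi : {ffun 'I_n -> 'I_m} => phi @: [set: 'I_n]%SET)
           (fun S : {set 'I_m} => #|S| == n)) /=; last first.
  by move=> phi /injectiveP inj; rewrite card_imset // cardsT card_ord.
apply: eq_bigr => S /eqP cardS; rewrite expand big_distrr /=.
rewrite [RHS](bigID (fun phi : {ffun 'I_n -> 'I_m} =>
                       phi @: [set: 'I_n]%SET == S)) /=.
rewrite [X in _ + X]big1 ?addr0 => [|phi /andP[/injectiveP inj neS]].
  apply: eq_bigr => phi /andP[/injectiveP inj /eqP imS].
  have -> : \prod_i (phi i \in S)%:R = 1 :> R.
    by rewrite big1 // => i _; rewrite -imS imset_f ?inE.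
  rewrite mul1r -imS big_imset /=; last by move=> ? ? _ _ /inj.
  by congr (_ * _); apply: eq_bigl => i; rewrite inE.
have /existsP[i iS] : [exists i, phi i \notin S].
  rewrite -negb_forall; apply: contra neS => /forallP sub.
  rewrite eqEcard cardS card_imset // cardsT card_ord leqnn andbT.
  by apply/fintype.subsetP => _ /imsetP[i _ ->].
by rewrite (bigD1 i) //= (negbTE iS) !mul0r mulr0.
Qed.

End CauchyBinet.

Section LaplacianCorank.
Variables (F : fieldType) (n : nat) (L : 'M[F]_n.+1).
Hypothesis row_sums0 : L *m const_mx 1 = 0 :> 'cV_n.+1.
Hypothesis col_sums0 : const_mx 1 *m L = 0 :> 'rV_n.+1.

Let ones := const_mx 1 : 'rV[F]_n.+1.

(** By linearity in the row 0, the perturbation adds the cofactor of index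
    (0, 0) to \det L, and \det L vanishes because the rows of L add up to 0. *)
Lemma det_add_delta00 :
  \det (L + delta_mx 0 0) = \det (row' 0 (col' 0 L)).
Proof.
have detL0 : \det L = 0.
  apply/eqP/det0P; exists ones => //.
  by apply/eqP => /rowP/(_ 0)/eqP; rewrite !mxE oner_eq0.
rewrite (expand_det_row _ 0).
transitivity (\sum_j (L 0 j + (j == 0)%:R) * cofactor L 0 j).
  apply: eq_bigr => j _; rewrite !mxE /=; congr (_ * (_ * \det _)).
  by apply/matrixP => i k; rewrite !mxE /= addr0.
under eq_bigr do rewrite mulrDl.
rewrite big_split /= -expand_det_row detL0 add0r (bigD1 0) //= big1 ?addr0.
  by rewrite mul1r /cofactor expr0 mul1r; congr (\det _);
    apply/matrixP => i j; rewrite !mxE.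
by move=> j /negbTE ->; rewrite mul0r.
Qed.

(** The constant vector is always in the kernel, so corank one means that
    there is nothing else there.  A vector killed by L + delta_mx 0 0 has
    a zero entry of index 0, as the sum of the entries of its image shows; it
    is then killed by L, and a constant vector with a zero entry is zero.
    Conversely, a perturbation of rank one raises the rank by at most one. *)
Lemma corank1_unitmx : corank L = 1%N <-> L + delta_mx 0 0 \in unitmx.
Proof.
have ones0 : ones != 0.
  by apply/eqP => /rowP/(_ 0)/eqP; rewrite !mxE oner_eq0.
have sub_ones : (ones <= kermx L)%MS by apply/sub_kermxP.
rewrite /corank; split => [rk|].
  have rkL : \rank L = n.
    by have := rank_leq_row L; lia.
  have kerE : (kermx L <= ones)%MS.
    rewrite -(geq_leqif (mxrank_leqif_sup sub_ones)).
    by rewrite mxrank_ker rkL subSnn rank_rV ones0.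
  rewrite -row_free_unit -kermx_eq0; apply/rowV0P => v /sub_kermxP.
  rewrite mulmxDr => vL.
  have v0 : v 0 0 = 0.
    have := congr1 (fun x : 'rV_n.+1 => (x *m (const_mx 1 : 'cV_n.+1)) 0 0) vL.
    rewrite mulmxDl -mulmxA row_sums0 mulmx0 add0r mul0mx [in RHS]mxE => <-.
    rewrite -mulmxA mxE (bigD1 0) //= big1 ?addr0.
      by rewrite mxE (bigD1 0) //= big1 ?addr0 ?mxE ?mulr1 //;
        move=> i /negbTE i0; rewrite !mxE i0 mul0r.
    move=> i /negbTE i0; rewrite !mxE big1 ?mulr0 // => k _.
    by rewrite !mxE i0 mul0r.
  have vE : v *m delta_mx 0 0 = 0 :> 'rV_n.+1.
    apply/rowP => j; rewrite !mxE big1 // => i _; rewrite !mxE.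
    by have [->|] := eqVneq i 0; rewrite ?v0 ?mul0r ?mulr0.
  move: vL; rewrite vE addr0 => /sub_kermxP/submx_trans/(_ kerE)/sub_rVP[a va].
  move: v0; rewrite va !mxE mulr1 => ->; by rewrite scale0r.
rewrite -row_free_unit => /eqP rk.
have h1 := mxrank_add L (delta_mx 0 0).
have h2 : (\rank ones <= \rank (kermx L))%N by apply: mxrankS.
move: h1 h2; rewrite rk mxrank_delta mxrank_ker rank_rV ones0.
by have := rank_leq_row L; lia.
Qed.

End LaplacianCorank.

(** * Connectedness, cycles and the incidence matrix *)

Section Incidence.
Variables (n m : nat) (G : digraph n m).

Lemma incidence_mxE (R : pzRingType) i j :
  incidence_mx G R i j = (i == tail G j)%:R - (i == Defs.head G j)%:R.
Proof.
rewrite mxE; have [->|_] := eqVneq i (tail G j).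
  by rewrite (negbTE (loopless G j)) subr0.
by case: eqP; rewrite ?subrr ?sub0r ?subr0 ?oppr0.
Qed.

Lemma sum_incidence (R : pzRingType) (y : 'I_n -> R) j :
  \sum_i y i * incidence_mx G R i j = y (tail G j) - y (Defs.head G j).
Proof.
under eq_bigr do rewrite incidence_mxE mulrBr.
have pick k : \sum_i y i * (i == k)%:R = y k.
  rewrite (bigD1 k) //= eqxx mulr1 big1 ?addr0 // => i /negbTE ->.
  by rewrite mulr0.
by rewrite sumrB !pick.
Qed.

Lemma map_incidence_mx (R : pzRingType) :
  map_mx intr (incidence_mx G int) = incidence_mx G R.
Proof.
apply/matrixP => i j; rewrite !mxE.
by do 2?case: ifP => // _; rewrite ?rmorphN.
Qed.

(** The sign makes the column of an edge the boundary of the step that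
    traverses it, whatever the direction of that step. *)
Lemma incidence_step (R : pzRingType) (s : 'I_m * bool) i :
  (-1) ^+ (~~ s.2) * incidence_mx G R i s.1 =
    (i == step_src G s)%:R - (i == step_dst G s)%:R.
Proof.
case: s => j [] /=; rewrite incidence_mxE /step_src /step_dst /= ?expr0
  ?mul1r //.
by rewrite expr1 mulN1r opprB.
Qed.

Definition edge_submx (R : pzRingType) (T : {set 'I_m}) : 'M[R]_(n, #|T|) :=
  colsub enum_val (incidence_mx G R).

(** The boundaries of the steps of a walk from u to v telescope.  No division
    occurs, so that this holds over the integers, which is what makes trees
    have determinant 1 or -1 below. *)
Lemma connect_boundary (R : pzRingType) (T : {set 'I_m}) u v :
  connect (adjacent_by G T) u v ->
  exists x : 'cV[R]_#|T|, edge_submx R T *m x = delta_mx u 0 - delta_mx v 0.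
Proof.
case/connectP => p; elim: p u => [|z p IH] u /=.
  by move=> _ ->; exists 0; rewrite mulmx0 subrr.
case/andP => /existsP[j /andP[jT uz]] /IH{}IH /IH[x xE].
have colT : col (enum_rank_in jT j) (edge_submx R T) =
            delta_mx (tail G j) 0 - delta_mx (Defs.head G j) 0.
  apply/colP => i; rewrite [LHS]mxE [LHS]mxE enum_rankK_in // incidence_mxE.
  by rewrite !mxE !andbT.
pose e := delta_mx (enum_rank_in jT j) 0 : 'cV[R]_#|T|.
case/orP: uz => /andP[/eqP <- /eqP zE]; [exists (e + x) | exists (x - e)];
  rewrite mulmxDr ?mulmxN xE /e -colE colT ?zE ?addrA ?subrK //.
by rewrite opprB addrC addrA subrK.
Qed.

Lemma cycle_dst_src (c : seq ('I_m * bool)) :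
  cycle (fun s t => step_dst G s == step_src G t) c ->
  perm_eq (map (step_dst G) c) (map (step_src G) c).
Proof.
case: c => // x p cyc.
suff: forall y q, path (fun s t => step_dst G s == step_src G t) y q ->
    map (step_dst G) (belast y q) = map (step_src G) q.
  move=> /(_ _ _ cyc); rewrite belast_rcons => ->.
  by rewrite map_rcons /= perm_rcons.
by move=> y q; elim: q y => //= z q IH y /andP[/eqP -> /IH ->].
Qed.

(** The boundaries of the steps of a closed walk add up to 0; the combination
    of columns is not the trivial one because a cycle uses each of its edges
    only once. *)
Lemma graph_cycle_dependency (F : fieldType) (T : {set 'I_m}) c :
  graph_cycle G T c ->
  exists2 x : 'cV[F]_#|T|, x != 0 & edge_submx F T *m x = 0.
Proof.
case/and5P => c0 /allP cT cyc uc _.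
exists (\col_k \sum_(s <- c | s.1 == enum_val k) (-1) ^+ (~~ s.2)).
  case: c c0 cT uc {cyc} => // s c _ cT /= /andP[sc _].
  have sT := cT _ (mem_head _ _).
  apply/eqP => /colP/(_ (enum_rank_in sT s.1)); rewrite !mxE enum_rankK_in //.
  rewrite big_cons eqxx big_seq_cond big1 ?addr0 => [|t /andP[tc /eqP ts]].
    by move/eqP; rewrite signr_eq0.
  by case/negP: sc; rewrite -ts map_f.
apply/colP => i; rewrite !mxE.
transitivity (\sum_(s <- c) (-1) ^+ (~~ s.2) * incidence_mx G F i s.1).
  under eq_bigr do rewrite !mxE mulr_sumr big_mkcond.
  rewrite exchange_big /= !big_seq; apply: eq_bigr => s sc.
  have sT := cT _ sc.
  rewrite (bigD1 (enum_rank_in sT s.1)) //= big1 ?addr0 => [|k nk].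
    by rewrite enum_rankK_in // eqxx !mxE mulrC.
  case: eqP => // sk; case/eqP: nk; apply: enum_val_inj.
  by rewrite enum_rankK_in.
under eq_bigr do rewrite incidence_step.
rewrite sumrB; apply/eqP; rewrite subr_eq0; apply/eqP.
rewrite -(big_map (step_src G) predT (fun v => (i == v)%:R)).
rewrite -(big_map (step_dst G) predT (fun v => (i == v)%:R)).
by apply: perm_big; rewrite perm_sym; apply: cycle_dst_src.
Qed.

(** A walk in a finite graph that can always be prolonged without going back
    at once along the same edge closes up.  The cycle is the shortest stretch
    of the walk between two visits of the same node: its inner nodes are
    distinct by minimality, and an edge used twice in it would have to be used
    in opposite directions at two consecutive steps, which is excluded. *)
Lemma endless_walk_cycle (T : {set 'I_m}) (nxt : 'I_m * bool -> 'I_m * bool)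
    (s0 : 'I_m * bool) :
  s0.1 \in T ->
  (forall s : 'I_m * bool, s.1 \in T -> [/\ (nxt s).1 \in T, (nxt s).1 != s.1 &
     step_src G (nxt s) = step_dst G s]) ->
  exists c, graph_cycle G T c.
Proof.
move=> s0T nxtP; pose w k := iter k nxt s0.
have wT k : (w k).1 \in T.
  by elim: k => //= k IH; have [] := nxtP _ IH.
have wS k : step_src G (w k.+1) = step_dst G (w k).
  by have [_ _] := nxtP _ (wT k).
have wN k : (w k.+1).1 != (w k).1 by have [] := nxtP _ (wT k).
pose revisit a d := step_src G (w a) = step_src G (w (a + d)%N).
have [d [d0 ad] dmin] : exists2 d, (0 < d)%N /\ exists a, revisit a d
    & forall e b, (0 < e)%N -> revisit b e -> (d <= e)%N.
  have ex : exists d, `[< (0 < d)%N /\ exists a, revisit a d >].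
    have : ~ injective (fun k : 'I_n.+1 => step_src G (w k)).
      by move/leq_card; rewrite !card_ord ltnn.
    move=> /injectiveP/injectivePn[a [b]].
    wlog ab : a b / (a < b)%N.
      move=> W; have [/W//|ba|/val_inj -> ] := ltngtP a b; last by rewrite eqxx.
      by rewrite eq_sym => ne /esym; apply: W.
    move=> _ e; exists (b - a)%N; apply/asboolP.
    by rewrite subn_gt0; split=> //; exists a; rewrite /revisit subnKC // ltnW.
  have [d /asboolP Pd dmin] := ex_minnP ex; exists d => // e b e0 be.
  by apply: dmin; apply/asboolP; split; last exists b.
case: ad => a ad.
have srcI i k : (i < k < d)%N ->
    step_src G (w (a + i)%N) <> step_src G (w (a + k)%N).
  move=> /andP[ik kd] e; have := dmin (k - i)%N (a + i)%N.
  rewrite /revisit subn_gt0 ik -addnA subnKC ?(ltnW ik) // => /(_ isT e).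
  by lia.
pose c := mkseq (fun k => w (a + k)%N) d.
have cE : c = traject nxt (w a) d.
  apply: (@eq_from_nth _ (w a)) => [|i].
    by rewrite size_mkseq size_traject.
  rewrite size_mkseq => id; rewrite nth_mkseq // nth_traject //.
  by rewrite /w addnC iterD.
exists c; apply/and5P; split.
- by rewrite -size_eq0 size_mkseq -lt0n.
- by apply/allP => _ /mapP[k _ ->].
- have wE k : iter k nxt (w a) = w (a + k)%N by rewrite /w addnC iterD.
  rewrite cE; case: d d0 ad {dmin srcI c cE} => // d _ ad.
  rewrite /= rcons_path last_traject wE -wS -addnS ad eqxx andbT.
  elim: d a {ad wE} => //= d IH a; rewrite -[nxt (w a)]/(w a.+1) -wS eqxx andTb.
  exact: (IH a.+1).
- rewrite -map_comp; apply/mkseq_uniqP.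
  suff H i k : (i < k)%N -> (k < d)%N -> (w (a + i)%N).1 <> (w (a + k)%N).1.
    move=> i k; rewrite !inE => id kd /= e.
    by case: (ltngtP i k) => // lt; [case: (H i k) | case: (H k i)].
  move=> ik kd e.
  (* The edge is used in opposite directions: in the same direction the two
     steps would have the same source. *)
  have srcE : step_src G (w (a + i)%N) = step_src G (w (a + k).+1).
    have := srcI i k; rewrite ik kd => /(_ isT); rewrite wS.
    move: e; rewrite /step_src /step_dst.
    by case: (w (a + i)%N) (w (a + k)%N) => [j []] [j' []] /= <-.
  have dstE : step_src G (w (a + i).+1) = step_src G (w (a + k)%N).
    have := srcI i k; rewrite ik kd => /(_ isT); rewrite wS.
    move: e; rewrite /step_src /step_dst.
    by case: (w (a + i)%N) (w (a + k)%N) => [j []] [j' []] /= <-.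
  have {srcE} kd1 : k.+1 = d.
    apply/eqP; rewrite eqn_leq kd /= leqNgt; apply/negP => kd1.
    apply: (srcI i k.+1); first by lia.
    by rewrite srcE addnS.
  have [ik1|ik1] := eqVneq i.+1 k.
    by have := wN (a + i)%N; rewrite e -ik1 addnS eqxx.
  apply: (srcI i.+1 k); first by lia.
  by rewrite addnS.
- rewrite -map_comp; apply/mkseq_uniqP => i k; rewrite !inE => id kd /= e.
  case: (ltngtP i k) => // lt.
    by case: (srcI i k); rewrite ?lt.
  by case: (srcI k i); rewrite ?lt.
Qed.

(** In a dependency between the columns, every node met by an edge with
    a nonzero coefficient is met by another such edge, since the entries of
    that row cancel.  One can thus walk forever along these edges, and they
    contain a cycle. *)
Lemma acyclic_independent (F : fieldType) (T : {set 'I_m}) (x : 'cV[F]_#|T|) :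
  acyclic G T -> edge_submx F T *m x = 0 -> x = 0.
Proof.
move=> acyc Ax0; apply/eqP/negPn/negP => /eqP x0.
have [k0 xk0] : exists k, x k 0 != 0.
  apply/existsP; rewrite -negb_forall; apply/negP => /forallP H.
  by apply: x0; apply/colP => k; rewrite mxE (eqP (H k)).
pose K : {set 'I_m} := [set enum_val k | k : 'I_#|T| & x k 0 != 0].
have KT : K \subset T.
  by apply/fintype.subsetP => _ /imsetP[k _ ->]; apply: enum_valP.
have step s : s.1 \in K -> exists t, [&& t.1 \in K, t.1 != s.1 &
    step_src G t == step_dst G s].
  case/imsetP => k; rewrite inE => xk sk.
  have incE i j : incidence_mx G F i j != 0 -> exists b, step_src G (j, b) = i.
    rewrite mxE; have [->|_] := eqVneq i (tail G j); first by exists true.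
    by have [->|_] := eqVneq i (Defs.head G j); [exists false | rewrite eqxx].
  have ne : incidence_mx G F (step_dst G s) s.1 * x k 0 != 0.
    rewrite mulf_neq0 // mxE /step_dst.
    case: s.2; last by rewrite eqxx oner_eq0.
    rewrite [_ == tail G _]eq_sym (negbTE (loopless G _)) eqxx.
    by rewrite oppr_eq0 oner_eq0.
  have [l lk lx] : exists2 l, l != k &
      incidence_mx G F (step_dst G s) (enum_val l) * x l 0 != 0.
    apply/exists_inP; rewrite -negb_forall_in; apply/negP => /forall_inP H.
    have := congr1 (fun y : 'cV_n => y (step_dst G s) 0) Ax0.
    rewrite !mxE (bigD1 k) //= big1 => [|l lk]; last first.
      by have := H l lk; rewrite !mxE => /eqP.
    by rewrite addr0 mxE -sk => /eqP; rewrite (negbTE ne).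
  move: lx; rewrite mulf_eq0 negb_or => /andP[/incE[b bE] xl].
  exists (enum_val l, b); rewrite bE eqxx andbT; apply/andP; split.
    by apply/imsetP; exists l; rewrite ?inE.
  by apply: contraNneq lk; rewrite sk => /enum_val_inj ->.
pose nxt s := odflt s [pick t : 'I_m * bool | [&& t.1 \in K, t.1 != s.1 &
    step_src G t == step_dst G s]].
have [||c cK] := @endless_walk_cycle K nxt (enum_val k0, true).
- by apply/imsetP; exists k0; rewrite ?inE.
- move=> s /step[t Pt]; rewrite /nxt.
  case: pickP => [u /and3P[? ? /eqP ?]|/(_ t)] //=.
  by rewrite Pt.
case/negP: (acyc c); case/and5P: cK => c1 c2 c3 c4 c5.
by apply/and5P; split=> //; apply: sub_all c2 => s /(fintype.subsetP KT).
Qed.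

End Incidence.

(** * The matrix-tree theorem *)

(** An integer matrix that is invertible over the integers has determinant 1
    or -1. *)
Lemma det_mul_tr_right_inverse n p (B : 'M[int]_(n, p)) (X : 'M[int]_(p, n)) :
  p = n -> B *m X = 1%:M -> \det (B *m B^T) = 1.
Proof.
move=> pn; case: n / pn B X => B X BX.
have : \det B * \det X = 1 by rewrite -det_mulmx BX det1.
rewrite mulrC det_mulmx det_tr => /intUnitRing.unitzPl.
by rewrite qualifE => /orP[] /eqP ->.
Qed.

Section MatrixTree.
Variables (n m : nat) (G : digraph n.+1 m).

(** The rows of the incidence matrix add up to 0, so one of them is
    redundant; dropping it gives square matrices for the spanning trees. *)
Definition grounded_edge_submx (R : pzRingType) (T : {set 'I_m}) :
  'M[R]_(n, #|T|) := row' ord0 (edge_submx G R T).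

Lemma grounded_edge_submxE (R : pzRingType) (T : {set 'I_m}) i k :
  grounded_edge_submx R T i k = incidence_mx G R (lift ord0 i) (enum_val k).
Proof. by rewrite !mxE. Qed.

Lemma grounded_edgesE (R : comPzRingType) (T : {set 'I_m}) :
  row' ord0 (incidence_mx G R) *m set_diag R T
    *m (row' ord0 (incidence_mx G R))^T
  = grounded_edge_submx R T *m (grounded_edge_submx R T)^T.
Proof.
apply/matrixP => i k; rewrite mxE [RHS]mxE.
under [RHS]eq_bigr do rewrite [_^T _ _]mxE !grounded_edge_submxE.
rewrite -(big_enum_val (A := mem T) (fun j => incidence_mx G R (lift ord0 i) j *
   incidence_mx G R (lift ord0 k) j)) [RHS]big_mkcond.
apply: eq_bigr => j _; rewrite mul_mx_diag !mxE.
by rewrite -[j \in mem T]/(j \in T); case: (j \in T);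
  rewrite ?mulr1 // mulr0 mul0r.
Qed.

Lemma grounded_kernel (R : pzRingType) (T : {set 'I_m}) (x : 'cV[R]_#|T|) :
  grounded_edge_submx R T *m x = 0 -> edge_submx G R T *m x = 0.
Proof.
move=> Bx; have liftE i : (edge_submx G R T *m x) (lift ord0 i) 0 = 0.
  transitivity ((grounded_edge_submx R T *m x) i 0); last by rewrite Bx mxE.
  by rewrite !mxE; apply: eq_bigr => k _; rewrite !mxE.
have sum0 : \sum_i (edge_submx G R T *m x) i 0 = 0.
  under eq_bigr do rewrite mxE.
  rewrite exchange_big big1 // => k _; rewrite -mulr_suml.
  under eq_bigr do rewrite mxE -[incidence_mx _ _ _ _]mul1r.
  by rewrite (sum_incidence G (fun=> 1)) subrr mul0r.
apply/colP => i; rewrite [RHS]mxE; have [j ->|->] := unliftP ord0 i.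
  exact: liftE.
by move: sum0; rewrite big_ord_recl [X in _ + X]big1 ?addr0.
Qed.

Lemma connected_grounded_right_inverse (R : pzRingType) (T : {set 'I_m}) :
  connected_by G T ->
  exists X : 'M[R]_(#|T|, n), grounded_edge_submx R T *m X = 1%:M.
Proof.
case/andP => _ /forallP conn.
have /fin_all_exists[x xE] i : exists x : 'cV[R]_#|T|,
    edge_submx G R T *m x = delta_mx (lift ord0 i) 0 - delta_mx ord0 0.
  by apply: connect_boundary; have /forallP := conn (lift ord0 i); apply.
exists (\matrix_(k, i) x i k 0); apply/matrixP => i j.
have /colP/(_ (lift ord0 i)) := xE j.
rewrite !mxE (inj_eq lift_inj) eqxx !andbT subr0 => <-.
by apply: eq_bigr => k _; rewrite grounded_edge_submxE !mxE.
Qed.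

Lemma adjacent_by_sym (T : {set 'I_m}) : symmetric (adjacent_by G T).
Proof.
move=> u v; apply: eq_existsb => j.
by rewrite orbC [(tail G j == v) && _]andbC [(Defs.head G j == v) && _]andbC.
Qed.

(** The cokernel vector is the indicator of the nodes that are not reached
    from the dropped node 0: it takes the same value at both ends of any edge
    of T. *)
Lemma disconnected_grounded_cokernel (R : nzRingType) (T : {set 'I_m}) :
  ~~ connected_by G T ->
  exists2 v : 'rV[R]_n, v != 0 & v *m grounded_edge_submx R T = 0.
Proof.
move=> disc; pose U := connect (adjacent_by G T) ord0.
have [w wU] : exists w, ~~ U w.
  apply/existsP; rewrite -negb_forall; apply: contra disc => /forallP H.
  apply/forallP => u; apply/forallP => v; apply: connect_trans (H v).
  by rewrite (sym_connect_sym (adjacent_by_sym T)); apply: H.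
exists (\row_i (~~ U (lift ord0 i))%:R).
  apply/eqP => /rowP; have [j wE|w0] := unliftP ord0 w.
    by move/(_ j)/eqP; rewrite !mxE -wE wU oner_eq0.
  by rewrite w0 /U connect0 in wU.
apply/rowP => k; rewrite !mxE.
transitivity (\sum_i (~~ U i)%:R * incidence_mx G R i (enum_val k)).
  rewrite [RHS]big_ord_recl (connect0 _ _ : U ord0) mul0r add0r.
  by apply: eq_bigr => i _; rewrite !mxE.
rewrite (sum_incidence G (fun i => (~~ U i)%:R)).
suff -> : U (tail G (enum_val k)) = U (Defs.head G (enum_val k)).
  by rewrite subrr.
have adj : adjacent_by G T (tail G (enum_val k)) (Defs.head G (enum_val k)).
  by apply/existsP; exists (enum_val k); rewrite enum_valP !eqxx.
apply/idP/idP => H; apply: connect_trans H _; apply: connect1 => //.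
by rewrite adjacent_by_sym.
Qed.

(** A tree has independent columns, which bounds their number by the n rows,
    and a connected graph has independent rows, which gives the converse
    bound. *)
Lemma spanning_tree_card (T : {set 'I_m}) : spanning_tree G T -> #|T| = n.
Proof.
case/andP => conn /asboolP acyc; apply/eqP; rewrite eqn_leq; apply/andP; split.
  have : row_free (grounded_edge_submx rat T)^T.
    rewrite -kermx_eq0; apply/rowV0P => v /sub_kermxP vB.
    apply: trmx_inj; rewrite trmx0; apply: (acyclic_independent acyc).
    by apply: grounded_kernel; rewrite -[LHS]trmxK trmx_mul trmxK vB trmx0.
  by move/eqP <-; apply: rank_leq_col.
have [X BX] := connected_grounded_right_inverse rat conn.
rewrite -[n in (n <= _)%N](mxrank1 rat) -BX.
exact: leq_trans (mxrankM_maxl _ _) (rank_leq_col _).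
Qed.

(** A set of n edges which is connected has independent rows, hence, being
    square, independent columns, so that it contains no cycle; its
    determinant is a unit of the integers.  When it is not connected the
    determinant vanishes. *)
Lemma det_grounded_edges (F : fieldType) (T : {set 'I_m}) : #|T| = n ->
  \det (grounded_edge_submx F T *m (grounded_edge_submx F T)^T)
  = (spanning_tree G T)%:R.
Proof.
move=> cardT; have [conn|disc] := boolP (connected_by G T); last first.
  rewrite /spanning_tree (negbTE disc); apply/eqP/det0P.
  have [v v0 vB] := disconnected_grounded_cokernel F disc.
  by exists v; rewrite // mulmxA vB mul0mx.
have -> : spanning_tree G T.
  rewrite /spanning_tree conn; apply/asboolP => c; apply/negP => cyc.
  have [x x0 Ax] := graph_cycle_dependency rat cyc.
  have [X BX] := connected_grounded_right_inverse rat conn.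
  have Bx : grounded_edge_submx rat T *m x = 0.
    have -> : grounded_edge_submx rat T *m x
              = row' ord0 (edge_submx G rat T *m x).
      by apply/colP => i; rewrite !mxE; apply: eq_bigr => k _; rewrite !mxE.
    by rewrite Ax; apply/colP => i; rewrite !mxE.
  have free : row_free (grounded_edge_submx rat T)^T.
    rewrite /row_free mxrank_tr eqn_leq rank_leq_col.
    by rewrite {1}cardT -[n in (n <= _)%N](mxrank1 rat) -BX mxrankM_maxl.
  case/eqP: x0; apply/trmx_inj/(row_free_inj free).
  by rewrite -trmx_mul Bx !trmx0 mul0mx.
have [X BX] := connected_grounded_right_inverse int conn.
have := congr1 (fun z : int => z%:~R : F) (det_mul_tr_right_inverse cardT BX).
rewrite -det_map_mx map_mxM -map_trmx rmorph1 => <-.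
have -> // : grounded_edge_submx F T = map_mx intr (grounded_edge_submx int T).
rewrite /grounded_edge_submx /edge_submx -(map_incidence_mx G F).
by apply/matrixP => i j; rewrite !mxE.
Qed.

(** Kirchhoff's theorem for arbitrary weights, from the Cauchy-Binet formula:
    the squared minor of an n-subset of the edges is 1 for a tree and 0
    otherwise. *)
Theorem matrix_tree (F : fieldType) (w : 'I_m -> F) :
  \det (row' ord0 (incidence_mx G F) *m diag_mx (\row_j w j)
        *m (row' ord0 (incidence_mx G F))^T) = tree_weight_sum G w.
Proof.
rewrite det_mul_diag_mx /tree_weight_sum big_mkcond [RHS]big_mkcond.
apply: eq_bigr => T _ /=; case: eqP => [cardT|cardT].
  rewrite grounded_edgesE det_grounded_edges //.
  by case: (spanning_tree G T); rewrite ?mulr1 ?mulr0.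
by case: ifP => // /spanning_tree_card.
Qed.

Lemma const_mul_incidence (R : pzRingType) :
  const_mx 1 *m incidence_mx G R = 0 :> 'rV_m.
Proof.
apply/rowP => j; rewrite mxE [RHS]mxE.
under eq_bigr do rewrite mxE.
by rewrite (sum_incidence G (fun=> 1)) subrr.
Qed.

Lemma tr_incidence_mul_const (R : comPzRingType) :
  (incidence_mx G R)^T *m const_mx 1 = 0 :> 'cV_m.
Proof.
by rewrite -[const_mx 1]trmxK trmx_const -trmx_mul const_mul_incidence trmx0.
Qed.

Section Laplacian.
Variables (F : fieldType) (w : 'I_m -> F).
Let L :=
  incidence_mx G F *m diag_mx (\row_j w j) *m (incidence_mx G F)^T.

Lemma laplacian_col_sums : const_mx 1 *m L = 0 :> 'rV_n.+1.
Proof. by rewrite !mulmxA const_mul_incidence !mul0mx. Qed.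

Lemma laplacian_row_sums : L *m const_mx 1 = 0 :> 'cV_n.+1.
Proof. by rewrite -!mulmxA tr_incidence_mul_const !mulmx0. Qed.

Lemma laplacian_unitmx :
  L + delta_mx 0 0 \in unitmx <-> tree_weight_sum G w <> 0.
Proof.
rewrite unitmxE (det_add_delta00 laplacian_col_sums) unitfE -matrix_tree.
have -> : row' 0 (col' 0 L) = row' ord0 (incidence_mx G F) *m
    diag_mx (\row_j w j) *m (row' ord0 (incidence_mx G F))^T.
  apply/matrixP => i k; rewrite !mxE; apply: eq_bigr => j _.
  by rewrite !mul_mx_diag !mxE.
by split => /eqP.
Qed.

Lemma corank_laplacian : corank L = 1%N <-> tree_weight_sum G w <> 0.
Proof.
rewrite -laplacian_unitmx.
exact: corank1_unitmx laplacian_row_sums laplacian_col_sums.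
Qed.

End Laplacian.

End MatrixTree.

(** * Differentials and curves of zeros *)

Section Calculus.
Variable R : realType.

Lemma differentiable_mulmx n p (M : 'M[R]_(p, n)) (x : 'cV[R]_n) :
  differentiable (mulmx M : 'cV[R]_n -> 'cV[R]_p) x.
Proof.
have -> : mulmx M = \sum_j (fun y : 'cV[R]_n => y j 0 *: col j M).
  apply/funext => y; rewrite fct_sumE; apply/colP => i.
  by rewrite mxE summxE; apply: eq_bigr => j _; rewrite !mxE mulrC.
apply: differentiable_sum => j; apply: differentiableZl.
exact: differentiable_coord.
Qed.

Lemma mulmx_continuous n p (M : 'M[R]_(p, n)) :
  continuous (mulmx M : 'cV[R]_n -> 'cV[R]_p).
Proof.
by move=> x; apply: differentiable_continuous; apply: differentiable_mulmx.
Qed.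

Lemma diff_mulmx n p (M : 'M[R]_(p, n)) (x h : 'cV[R]_n) :
  'd (mulmx M : 'cV[R]_n -> 'cV[R]_p) x h = M *m h.
Proof. by rewrite diff_lin //; apply: mulmx_continuous. Qed.

Lemma jacobian_mx_diff n p (F : 'cV[R]_n -> 'cV[R]_p) (x : 'cV[R]_n) M :
  differentiable F x -> (forall h, 'd F x h = M *m h) -> jacobian_mx F x = M.
Proof.
move=> dF dFE; apply/matrixP => i j; rewrite mxE.
have := derive_mx (diff_derivable (v := delta_mx j 0) dF).
by rewrite deriveE // dFE -colE => /colP/(_ i); rewrite !mxE => ->.
Qed.

Section DiagMap.
Variables (m : nat) (f : 'I_m -> R -> R).
Hypothesis df : forall u : 'cV[R]_m, differentiable (diag_map f) u.

(** The function f j is diag_map f along the diagonal, read at the entry j. *)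
Lemma diag_map_differentiable j t : differentiable (f j) t.
Proof.
have -> : f j = (fun u : 'cV[R]_m => u j 0) \o diag_map f \o
    (fun t : R => t *: (const_mx 1 : 'cV[R]_m)).
  by apply/funext => s /=; rewrite !mxE mulr1.
apply: differentiable_comp; first by apply: differentiableZl.
apply: differentiable_comp; first exact: df.
exact: differentiable_coord.
Qed.

Lemma diff_diag_map u h :
  'd (diag_map f) u h = \col_j (derive1 (f j) (u j 0) * h j 0).
Proof.
rewrite -deriveE // (derive_mx (diff_derivable (v := h) (df u))).
apply/colP => j; rewrite mxE [RHS]mxE.
have -> : (fun v : 'cV[R]_m => diag_map f v j 0)
          = f j \o (fun v : 'cV[R]_m => v j 0).
  by apply/funext => v; rewrite mxE.
have dc : differentiable (fun v : 'cV[R]_m => v j 0 : R) u.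
  exact: differentiable_coord.
rewrite deriveE; last first.
  by apply: differentiable_comp => //; apply: diag_map_differentiable.
rewrite diff_comp //=; last exact: diag_map_differentiable.
rewrite deriv1E; last by apply/derivable1_diffP; apply: diag_map_differentiable.
have -> : 'd (fun v : 'cV[R]_m => v j 0 : R) u h = h j 0.
  rewrite -deriveE //.
  have := derive_mx (@derivable_id R 'cV[R]_m u h).
  by rewrite derive_id => /colP/(_ j); rewrite !mxE => <-.
by rewrite /= mulrC.
Qed.

End DiagMap.

Section Flow.
Variables (n m : nat) (A : 'M[R]_(n, m)) (f : 'I_m -> R -> R).
Hypothesis df : forall u : 'cV[R]_m, differentiable (diag_map f) u.
Let F (x : 'cV[R]_n) : 'cV[R]_n := - (A *m diag_map f (A^T *m x)).

Lemma flow_differentiable x : differentiable F x.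
Proof.
apply: differentiableN.
apply: (differentiable_comp (g := mulmx A) (f := diag_map f \o mulmx A^T)).
  by apply: differentiable_comp => //; apply: differentiable_mulmx.
exact: differentiable_mulmx.
Qed.

Lemma diff_flow x h :
  'd F x h =
    - (A *m diag_mx (\row_j derive1 (f j) ((A^T *m x) j 0)) *m A^T) *m h.
Proof.
have dAT : differentiable (mulmx A^T : 'cV[R]_n -> 'cV[R]_m) x.
  exact: differentiable_mulmx.
have dfA : differentiable (diag_map f \o mulmx A^T : 'cV[R]_n -> 'cV[R]_m) x.
  exact: differentiable_comp.
have -> : F = - ((mulmx A : 'cV[R]_m -> 'cV[R]_n)
                 \o (diag_map f \o mulmx A^T)) by [].
rewrite diffN; last first.
  by apply: differentiable_comp => //; apply: differentiable_mulmx.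
rewrite diff_comp //; last exact: differentiable_mulmx.
rewrite diff_comp // {dfA}.
transitivity (- 'd (mulmx A : 'cV[R]_m -> 'cV[R]_n) (diag_map f (A^T *m x))
   ('d (diag_map f) (A^T *m x)
      ('d (mulmx A^T : 'cV[R]_n -> 'cV[R]_m) x h))) => //.
rewrite diff_mulmx diff_mulmx diff_diag_map //.
rewrite mulNmx -!mulmxA; congr (- (A *m _)).
by apply/colP => j; rewrite mul_diag_mx !mxE.
Qed.

End Flow.

(** On K the differential at x is bounded below, as Q inverts it there, while
    F (x + h) - F x - 'd F x h is negligible with respect to h.  Thus no small
    nonzero h in K leaves F unchanged.  Differentiability at the single point
    x is enough. *)
Lemma isolated_level n p (F : 'cV[R]_n -> 'cV[R]_p) (x : 'cV[R]_n)
    (Q : 'M[R]_(n, p)) (K : set 'cV[R]_n) :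
  differentiable F x -> (forall h, K h -> Q *m 'd F x h = h) ->
  exists2 e : R, 0 < e & forall h, K h -> `|h| < e -> F (x + h) = F x -> h = 0.
Proof.
move=> dF QK.
have [k k0 Qk] := linear_lipschitz (@mulmx_continuous _ _ Q).
have /eqaddoP oF := diff_locally dF.
(* With this precision, Q turns the remainder into at most half of h. *)
have e20 : 0 < (2 * k)^-1 by rewrite invr_gt0 mulr_gt0.
have /nbhs_ballP[e /= e0 oFe] := oF _ e20.
exists e => // h Kh he Fh.
have bh : ball (0 : 'cV[R]_n) e h by rewrite -ball_normE /ball_ /= sub0r normrN.
have := oFe _ bh; rewrite /= !fctE /= [h + x]addrC Fh opprD addNKr normrN => dh.
apply/eqP; rewrite -normr_le0 -(QK _ Kh).
have le2 : `|Q *m 'd F x h| <= 2^-1 * `|h|.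
  apply: le_trans (Qk _) _.
  apply: le_trans (ler_wpM2l (ltW k0) dh) _.
  by rewrite invfM mulrA mulrCA mulfV ?mulr1 // gt_eqF.
rewrite QK // in le2 *.
have := normr_ge0 h; lra.
Qed.

Lemma class_C_cst k n p (U : set 'cV[R]_n) (c : 'cV[R]_p) : class_C k U (cst c).
Proof.
elim: k c => [|k IH] c /=; first by move=> x _; apply: cst_continuous.
split=> [x _|v]; first exact: differentiable_cst.
have -> : (fun x => 'D_v (cst c) x) = cst 0.
  by apply/funext => x; rewrite derive_cst.
exact: IH.
Qed.

Lemma smooth_on_affine n p (U : set 'cV[R]_n) (M : 'M[R]_(p, n))
    (b : 'cV[R]_p) :
  smooth_on U (fun x => M *m x + b).
Proof.
have -> : (fun x => M *m x + b)
          = (mulmx M : 'cV[R]_n -> 'cV[R]_p) + cst b by [].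
have dM x := differentiable_mulmx M x.
have d x : differentiable ((mulmx M : 'cV[R]_n -> 'cV[R]_p) + cst b) x.
  exact/differentiableD/differentiable_cst.
case=> [|k] /=; first by move=> x _; apply: differentiable_continuous.
split=> // v.
have -> : (fun x => 'D_v ((mulmx M : 'cV[R]_n -> 'cV[R]_p) + cst b) x)
          = cst (M *m v).
  apply/funext => x.
  rewrite deriveD; [|exact: diff_derivable|exact: derivable_cst].
  by rewrite derive_cst addr0 deriveE // diff_mulmx.
exact: class_C_cst.
Qed.

Lemma mulmx_row_entry n (z : 'cV[R]_n.+1) (c : 'cV[R]_n.+1) :
  c *m (delta_mx 0 0 *m z) = z 0 0 *: c :> 'cV[R]_n.+1.
Proof.
by apply/colP => i; rewrite -rowE !mxE big_ord1 !mxE mulrC.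
Qed.

(** When F does not see translations along the diagonal, and its differential
    at x is injective on the complement h 0 0 = 0 of the diagonal, the zeros
    of F near x are just the points of the line through x directed by the
    diagonal: the component of a nearby zero in the complement is a small
    displacement that leaves F unchanged.  A line is a submanifold by means
    of one affine chart. *)
Lemma translation_invariant_curve n (F : 'cV[R]_n.+1 -> 'cV[R]_n.+1)
    (x : 'cV[R]_n.+1) (Q : 'M[R]_n.+1) :
  (forall y c, F (y + c *: const_mx 1) = F y) -> F x = 0 ->
  differentiable F x ->
  (forall h : 'cV[R]_n.+1, h 0 0 = 0 -> Q *m 'd F x h = h) ->
  locally_curve (equilibria F) x.
Proof.
move=> Finv Fx dF QF; split=> //.
have [e e0 iso] := isolated_level (K := [set h | h 0 0 = 0]) dF QF.
pose E : 'rV[R]_n.+1 := delta_mx 0 0.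
have cE (c z : 'cV[R]_n.+1) : c *m (E *m z) = z 0 0 *: c := mulmx_row_entry z c.
(* The projection onto the complement along the diagonal. *)
pose P : 'M[R]_n.+1 := 1%:M - const_mx 1 *m E.
have PE (z : 'cV[R]_n.+1) : P *m z = z - z 0 0 *: const_mx 1.
  by rewrite mulmxBl mul1mx -mulmxA cE.
have P0 (z : 'cV[R]_n.+1) : (P *m z) 0 0 = 0 by rewrite PE !mxE mulr1 subrr.
have FP (z : 'cV[R]_n.+1) : F (x + P *m z) = F (x + z).
  by rewrite PE addrA -scaleNr Finv.
pose N := (fun y : 'cV[R]_n.+1 => P *m (y - x)) @^-1` ball 0 e.
exists N; split.
- apply: open_comp; last exact: ball_open.
  move=> y _; apply: differentiable_continuous.
  apply: (differentiable_comp (f := fun y => y - x) (g := mulmx P)).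
    by apply: differentiableB; [exact: ex_diff|exact: differentiable_cst].
  exact: differentiable_mulmx.
- by rewrite /N /preimage /= subrr mulmx0; apply: ballxx.
have lineP y : (equilibria F `&` N) y <-> P *m (y - x) = 0.
  split=> [[Fy Ny]|Py].
    apply: iso; [exact: P0 | | by rewrite FP subrKC Fy Fx].
    by move: Ny; rewrite /N /= -ball_normE /ball_ /= sub0r normrN.
  split; last by rewrite /N /preimage /= Py; apply: ballxx.
  by rewrite /equilibria /= -(subrKC x y) -FP Py addr0.
split=> // p _.
(* The chart keeps the entry 0 of y - x and subtracts it from all the
   others; it is a transvection, so changing a sign inverts it. *)
pose V : 'cV[R]_n.+1 := const_mx 1 - delta_mx 0 0.
have EV : E *m V = 0.
  by apply/rowP => i; rewrite -rowE !mxE ord1 subrr.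
pose B := 1%:M - V *m E; pose C := 1%:M + V *m E.
have VEVE : V *m E *m (V *m E) = 0.
  by rewrite -mulmxA (mulmxA E) EV mul0mx mulmx0.
have BC : B *m C = 1%:M.
  by rewrite mulmxDr mulmx1 mulmxBl mul1mx VEVE subr0 subrK.
have CB : C *m B = 1%:M.
  by rewrite mulmxDl mul1mx mulmxBr mulmx1 VEVE subr0 subrK.
exists setT, setT, (fun y => B *m y + - (B *m x)), (fun y => C *m y + x).
split; [exact: openT|exact: openT|by []| |].
  split; [exact: smooth_on_affine|exact: smooth_on_affine| |] => y _;
    split=> //.
    by rewrite mulmxDr mulmxN !mulmxA CB !mul1mx subrK.
  by rewrite mulmxDr mulmxA BC mul1mx addrK.
move=> y _; rewrite lineP.
have BE (i : 'I_n.+1) : (0 < i)%N -> (B *m y - B *m x) i 0 = (P *m (y - x)) i 0.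
  move=> i0; rewrite -mulmxBr PE mulmxBl mul1mx -mulmxA cE.
  by rewrite !mxE -val_eqE /= (gtn_eqF i0) subr0.
split=> [Py i i0|By]; first by rewrite BE // Py mxE.
apply/colP => i; rewrite [RHS]mxE.
have [i0|] := ltnP 0 i; first by rewrite -BE ?By.
rewrite leqn0 => /eqP i0; have -> : i = 0 by apply: val_inj.
exact: P0.
Qed.

End Calculus.

(** * Equilibria of the diffusive system *)

Theorem theorem3 (R : realType) (n m : nat) (G : digraph n m)
    (f : 'I_m -> R -> R) (xstar : 'cV[R]_n) :
  let A : 'M[R]_(n, m) := incidence_mx G R in
  let F : 'cV[R]_n -> 'cV[R]_n := fun x => - (A *m diag_map f (A^T *m x)) in
  let w : 'I_m -> R := fun j => derive1 (f j) ((A^T *m xstar) j 0) in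
  let W : 'M[R]_m := diag_mx (\row_j w j) in
  digraph_connected G ->
  (forall u : 'cV[R]_m, differentiable (diag_map f) u) ->
  equilibria F xstar ->
  [/\ differentiable F xstar,
      jacobian_mx F xstar = - (A *m W *m A^T),
      corank (jacobian_mx F xstar) = 1%N <-> tree_weight_sum G w <> 0
    & tree_weight_sum G w <> 0 -> locally_curve (equilibria F) xstar].
Proof.
move=> A F w W conn df Fx.
have dF := flow_differentiable A df xstar.
have dFE := diff_flow A df xstar.
have jacE : jacobian_mx F xstar = - (A *m W *m A^T) by apply: jacobian_mx_diff.
case: n => [|n'] in G xstar A F w W conn Fx dF dFE jacE *.
  by case/andP: conn.
split=> //; first by rewrite jacE /corank mxrank_opp; apply: corank_laplacian.
move=> /laplacian_unitmx unitL.
apply: (translation_invariant_curve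
          (Q := - invmx (A *m W *m A^T + delta_mx 0 0))) => // [y c|h h0].
  by rewrite /F mulmxDr -scalemxAr tr_incidence_mul_const scaler0 addr0.
have -> : 'd F xstar h = - ((A *m W *m A^T + delta_mx 0 0) *m h).
  rewrite dFE mulNmx mulmxDl.
  suff -> : delta_mx 0 0 *m h = 0 :> 'cV_n'.+1 by rewrite addr0.
  apply/colP => i; rewrite !mxE big1 // => j _; rewrite !mxE.
  by have [->|] := eqVneq j 0; rewrite ?h0 ?mulr0 // andbF mul0r.
by rewrite mulmxN mulNmx opprK mulKmx.
Qed.
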